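(* Let $G$ be a finite group and $p$ a prime. Then the following statements are equivalent: (1) $G$ is $p$-closed; (2) $\mathscr{C}_p(G)$ is homotopy equivalent to a discrete space of $|G|_{p'}$ points; (3) $\mathscr{C}_p(G)$ has exactly $|G|_{p'}$ connected components. In particular, whenever these equivalent conditions hold, $\chi(\mathscr{C}_p(G))=|G|_{p'}$.
   Context: $\mathscr{C}_p(G)$ is the poset, ordered by inclusion, of all right cosets $Hx$ ($x\in G$) of $p$-subgroups $H$ of $G$ (including the trivial subgroup). $G$ is $p$-closed if it has a normal Sylow $p$-subgroup. $|G|_{p'}$ is the largest positive divisor of $|G|$ coprime to $p$. For a finite poset $\mathcal{P}$, $\Delta\mathcal{P}$ is its order complex (simplices are finite chains); topological statements about $\mathcal{P}$ (homotopy equivalence, connected components) refer to the geometric realization $|\Delta\mathcal{P}|$; and $\chi(\mathcal{P})=\sum_{i\ge 0}(-1)^i\#\{\text{chains of } i+1 \text{ elements}\}$ is the (non-reduced) Euler characteristic of $\Delta\mathcal{P}$. *)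

(* Defs.v *)
From HB Require Import structures.
From mathcomp Require Import all_boot all_order all_algebra all_fingroup all_solvable.
From mathcomp Require Import all_classical all_reals topology normedtype.
Import numFieldNormedType.Exports.

Set Implicit Arguments.
Unset Strict Implicit.
Unset Printing Implicit Defensive.

Import Order.TTheory GRing.Theory Num.Theory.
(* Orders {set T} by inclusion; coset_poset below inherits this order. *)
Import Order.DefaultSetSubsetOrder.

Section CosetPoset.
Local Open Scope group_scope.
Context {gT : finGroupType} (p : nat) (G : {group gT}).

Definition p_closed : Prop :=
  exists2 P : {group gT}, p.-Sylow(G) P & P <| G.

Definition pcosets : {set {set gT}} :=
  [set A : {set gT} | [exists H : {group gT}, [exists x in G,
     [&& H \subset G, p.-group H & A == H :* x]]]].

Record coset_poset : Type :=
  CosetPoset { coset_val :> {set gT}; _ : coset_val \in pcosets }.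

HB.instance Definition _ := [isSub for coset_val].
HB.instance Definition _ := [Finite of coset_poset by <:].
HB.instance Definition _ :=
  [SubChoice_isSubPOrder of coset_poset by <:
     with Order.SetSubsetOrder.subset_display].

End CosetPoset.

Section OrderComplex.
Context {d : Order.disp_t} (P : finPOrderType d).

Definition is_chain (s : {set P}) : bool :=
  [forall x in s, forall y in s, (x >=< y)%O].

Definition order_complex : {set {set P}} :=
  [set s : {set P} | (s != finset.set0) && is_chain s].

(* A chain has at most #|P| elements, so no term of the alternating sum over
   all dimensions is lost by bounding i. *)
Definition euler_char : int :=
  (\sum_(i < #|P|)
     (-1) ^+ i * #|[set s in order_complex | #|s| == i.+1]|%:Z)%R.

End OrderComplex.

Local Open Scope classical_set_scope.
Local Open Scope ring_scope.

(* The geometric realization of a simplicial complex K (given by its nonempty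
   simplices) on a finite vertex set V, in barycentric coordinates.  Since V is
   finite, the topology induced by the product topology on V -> R is the weak
   topology of the complex. *)
Definition realization_set (R : realType) (V : finType) (K : {set {set V}}) :
    set {ptws V -> R} :=
  [set w | [/\ forall v, 0 <= w v, \sum_v w v = 1
             & [set v : V | w v != 0]%SET \in K]].

Definition realization (R : realType) (V : finType) (K : {set {set V}}) :
    topologicalType := set_type (@realization_set R V K).

(* H is total on R * X, but only its restriction to [0, 1] * X is constrained;
   any homotopy on [0, 1] * X extends arbitrarily, Y being inhabited by f x. *)
Definition homotopic (R : realType) (X Y : topologicalType) (f g : X -> Y) :=
  exists H : R * X -> Y,
    [/\ {within `[0, 1] `*` [set: X], continuous H},
        forall x, H (0, x) = f x & forall x, H (1, x) = g x].

Definition homotopy_equivalent (R : realType) (X Y : topologicalType) :=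
  exists (f : X -> Y) (g : Y -> X),
    [/\ continuous f, continuous g,
        homotopic R (g \o f) id & homotopic R (f \o g) id].

Definition components (X : topologicalType) : set (set X) :=
  [set connected_component [set: X] x | x in [set: X]].
Arguments components X : clear implicits.

(* Main.v *)
Require Import Defs.
From mathcomp Require Import all_boot all_order all_algebra all_fingroup all_solvable.
From mathcomp Require Import all_classical all_reals topology normedtype.
Import Order.TTheory GRing.Theory Num.Theory numFieldNormedType.Exports.

(** Write n for the p'-part of |G|, which is |G : P| for a Sylow p-subgroup P.

    If P is normal, then it contains every p-subgroup H of G, and A |-> P A
    sends each coset A = H x to the coset P x containing it, with comparable
    cosets going to the same P x.  The poset is thus a disjoint union of n
    pieces, with no relation between different pieces, each having a greatest
    element ([normal_Sylow_cones]).  Sliding every point of the realization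
    along a straight line to the greatest element of its piece yields the
    homotopy equivalence with n points
    ([cone_partition_homotopy_equivalent]).  On the level of chains, adding or
    removing that greatest element cancels all of the Euler characteristic
    except 1 for each piece ([cone_partition_euler_char]).

    A homotopy equivalence with a discrete space induces a bijection of
    connected components ([homotopy_equivalent_discrete_components]).

    It remains to recover P normal from the number of components.  Points in a
    common simplex are joined by a segment, so that every component contains a
    singleton coset {x}, and {h x}, {x} lie in one component (through H x)
    whenever h lies in a p-subgroup H.  The elements g such that {g x} and {x}
    are in one component for all x form a subgroup S of G; it contains all
    p-subgroups, and there are at most |G : S| components
    ([components_le_index]).  If there are n = |G : P| of them, then
    |G : P| <= |G : S| with P <= S, so S = P; as S contains all conjugates of
    P, the subgroup P is normal. *)

Set Implicit Arguments.
Unset Strict Implicit.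
Unset Printing Implicit Defensive.

Local Open Scope ring_scope.
Local Open Scope classical_set_scope.

(** * Homotopies and connected components *)

Lemma homotopic_component (R : realType) (X Y : topologicalType)
    (f g : X -> Y) (x : X) : homotopic R f g ->
  connected_component [set: Y] (f x) = connected_component [set: Y] (g x).
Proof.
move=> [H [cH H0 H1]]; apply: same_connected_component.
have c01 : connected ((fun t : R => (t, x)) @` `[0, 1]).
  apply: connected_continuous_connected; first exact: segment_connected.
  apply: continuous_subspaceT => t; rewrite /continuous_at /=.
  apply: (@cvg_pair _ _ _ (nbhs t) (nbhs t) (nbhs x) _ _ _ id (fun=> x)).
    exact: cvg_id.
  exact: cvg_cst.
(* the track of x under the homotopy *)
exists (H @` ((fun t : R => (t, x)) @` `[0, 1])); last first.
  by exists (1, x) => //; exists 1 => //=; rewrite in_itv /= ler01 lexx.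
split=> //.
  by exists (0, x) => //; exists 0 => //=; rewrite in_itv /= ler01 lexx.
apply: connected_continuous_connected => //.
by apply: continuous_subspaceW cH => _ [t t01 <-].
Qed.

Lemma connected_component_continuous (X Y : topologicalType) (f : X -> Y)
    (x y : X) : continuous f ->
  connected_component [set: X] x = connected_component [set: X] y ->
  connected_component [set: Y] (f x) = connected_component [set: Y] (f y).
Proof.
move=> cf xy; apply: same_connected_component.
exists (f @` connected_component [set: X] x); last first.
  by exists y => //; rewrite xy; exact: connected_component_refl.
split=> //; first by exists x => //; exact: connected_component_refl.
apply: connected_continuous_connected; first exact: component_connected.
exact: continuous_subspaceT.
Qed.

Lemma discrete_component (T : discreteTopologicalType) (x : T) :
  connected_component [set: T] x = [set x].
Proof.
exact: (zero_dimension_totally_disconnected discrete_zero_dimension).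
Qed.

(** With f : X -> T and g : T -> X inverse up to homotopy, the component of x
    is that of g (f x), so t |-> component of g t is onto; it is injective
    because f (g t) lies in the component of t, which is {t}. *)
Lemma homotopy_equivalent_discrete_components (R : realType)
    (X : topologicalType) (T : choiceType) :
  homotopy_equivalent R X (discrete_topology T) ->
  (components X #= [set: T])%card.
Proof.
move=> [f [g [cf cg gf fg]]]; pose D := discrete_topology T.
have -> : components X =
    (fun t => connected_component [set: X] (g t)) @` [set: D].
  apply/seteqP; split => C.
    by move=> [x _ <-]; exists (f x) => //; exact: (homotopic_component x gf).
  by move=> [t _ <-]; exists (g t).
apply: inj_card_eq => s t _ _ /(connected_component_continuous cf).
have fgE (u : D) : f (g u) = u.
  have := homotopic_component u fg.
  by rewrite !discrete_component => /seteqP[+ _]; move=> /(_ (f (g u))); exact.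
by rewrite !fgE !discrete_component => /seteqP[+ _]; move=> /(_ s); exact.
Qed.

(** * Realizations of simplicial complexes *)

Section Realization.
Context (R : realType) (V : finType) (K : {set {set V}}).
Local Notation X := (realization R K).

Lemma realization_inj (x y : X) : (forall v, val x v = val y v) -> x = y.
Proof. by move=> xy; apply/val_inj/funext. Qed.

Lemma continuous_realization (T : topologicalType) (f : T -> X) :
  (forall v, continuous (fun t => val (f t) v : R)) -> continuous f.
Proof.
move=> cf; have cval : continuous (fun t => val (f t)).
  move=> t; apply/cvg_sup => v; apply/cvg_image.
    by rewrite eqEsubset; split => y // _; exists (fun _ => y).
  move=> A /(cf v t A) /= At; rewrite nbhs_simpl.
  exists [set w : V -> R | A (w v)] => //.
  rewrite eqEsubset; split => y /=; first by move=> [w Aw <-].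
  by move=> Ay; exists (fun=> y).
apply/continuousP => _ [B oB <-]; rewrite set_valE.
by move/continuousP : cval; exact.
Qed.

Lemma coordinate_continuous v : continuous (fun x : X => val x v : R).
Proof.
rewrite -set_valE => x.
apply: (@continuous_comp _ {ptws V -> R} R set_val (proj v)).
  exact: initial_continuous.
exact: (@proj_continuous V (fun=> R) v).
Qed.

(** The unique simplex containing x in its interior. *)
Definition carrier (x : X) : {set V} := [set v | val x v != 0]%SET.

Lemma carrier_simplex (x : X) : carrier x \in K.
Proof. by case: (set_valP x). Qed.

Lemma open_star (v : V) : open [set x : X | v \in carrier x].
Proof.
rewrite (_ : mkset _ = (fun x => val x v : R) @^-1` [set~ 0]).
  apply: open_comp; first by move=> x _; exact: coordinate_continuous.
  exact/closed_openC/closed_eq.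
by apply/seteqP; split => x /=; rewrite inE => /eqP.
Qed.

Lemma vertex_realization (v : V) : [set v]%SET \in K ->
  @realization_set R V K (fun u => (u == v)%:R).
Proof.
move=> vK; split.
- by move=> u; exact: ler0n.
- by rewrite (bigD1 v) //= eqxx big1 ?addr0 // => u /negbTE ->.
- rewrite (_ : finset _ = [set v]%SET) //; apply/setP => u.
  by rewrite !inE pnatr_eq0 eqb0 negbK.
Qed.

Definition vertex (v : V) (vK : [set v]%SET \in K) : X :=
  exist (fun w => w \in @realization_set R V K) _
    (mem_set (vertex_realization vK)).

Lemma carrier_vertex (v : V) (vK : [set v]%SET \in K) :
  carrier (vertex vK) = [set v]%SET.
Proof. by apply/setP => u; rewrite !inE pnatr_eq0 eqb0 negbK. Qed.

(** The carrier of a point of the segment is that of an endpoint, or the union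
    of both for an inner point. *)
Lemma segment_realization (x y : X) (t : R) :
  carrier x :|: carrier y \in K -> 0 <= t <= 1 ->
  @realization_set R V K (fun v => (1 - t) * val x v + t * val y v).
Proof.
move=> xyK /andP[t0 t1].
have [x0 x1 xK] := set_valP x; have [y0 y1 yK] := set_valP y.
have s0 : 0 <= 1 - t by rewrite subr_ge0.
split.
- by move=> v; apply: addr_ge0; apply: mulr_ge0.
- by rewrite big_split /= -!mulr_sumr x1 y1 !mulr1 subrK.
- have [->|tn0] := eqVneq t 0.
    rewrite (_ : finset _ = carrier x) //; apply/setP => v.
    by rewrite !inE subr0 mul1r mul0r addr0.
  have [->|tn1] := eqVneq t 1.
    rewrite (_ : finset _ = carrier y) //; apply/setP => v.
    by rewrite !inE subrr mul1r mul0r add0r.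
  rewrite (_ : finset _ = carrier x :|: carrier y) //.
  apply/setP => v; rewrite !inE.
  have tv : 0 < t by rewrite lt_neqAle eq_sym tn0.
  have sv : 0 < 1 - t by rewrite subr_gt0 lt_neqAle tn1.
  rewrite paddr_eq0; [|exact: mulr_ge0|exact: mulr_ge0].
  by rewrite !mulf_eq0 (gt_eqF sv) (gt_eqF tv) negb_and.
Qed.

(** Truncating the parameter to [0, 1] makes the segment below defined and
    continuous on the whole line. *)
Definition clamp (t : R) : R := Num.max 0 (Num.min 1 t).

Lemma clamp_itv (t : R) : 0 <= clamp t <= 1.
Proof. by rewrite /clamp le_max lexx ge_max ler01 ge_min lexx. Qed.

Lemma clamp_continuous : continuous clamp.
Proof.
apply: max_fun_continuous; first by move=> x; exact: cvg_cst.
by apply: min_fun_continuous; move=> x; [exact: cvg_cst|exact: cvg_id].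
Qed.

Definition segment (x y : X) (xyK : carrier x :|: carrier y \in K) (t : R) :
    X :=
  exist (fun w => w \in @realization_set R V K) _
    (mem_set (segment_realization xyK (clamp_itv t))).

(** Two maps are contiguous when f x and g x always lie in a common simplex;
    the segments joining them there form a homotopy. *)
Lemma contiguous_homotopic (T : topologicalType) (f g : T -> X) :
  continuous f -> continuous g ->
  (forall x, carrier (f x) :|: carrier (g x) \in K) -> homotopic R f g.
Proof.
move=> cf cg fgK; exists (fun u => segment (fgK u.2) u.1); split.
- apply/continuous_subspaceT/continuous_realization => v.
  have cl : continuous (fun u : R * T => clamp u.1).
    move=> z; apply: (@continuous_comp _ _ _ fst clamp); first exact: cvg_fst.
    exact: clamp_continuous.
  have ccoord (h : T -> X) : continuous h ->
      continuous (fun u : R * T => val (h u.2) v : R).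
    move=> ch z.
    apply: (@continuous_comp _ _ _ snd (fun x => val (h x) v : R)).
      exact: cvg_snd.
    apply: (@continuous_comp _ _ _ h (fun x => val x v : R)); first exact: ch.
    exact: coordinate_continuous.
  move=> u; rewrite /continuous_at /=; apply: (@cvgD _ R^o).
    apply: (@cvgM R _); last exact: (ccoord f).
    by apply: (@cvgB _ R^o); [exact: cvg_cst|exact: cl].
  by apply: (@cvgM R); [exact: cl|exact: (ccoord g)].
- move=> x; apply: realization_inj => v /=.
  rewrite /clamp (min_idPr _) ?ler01 // maxxx.
  by rewrite subr0 mul1r mul0r addr0.
- move=> x; apply: realization_inj => v /=.
  rewrite /clamp minxx (max_idPr _) ?ler01 //.
  by rewrite subrr mul1r mul0r add0r.
Qed.

Lemma same_simplex_component (x y : X) : carrier x :|: carrier y \in K ->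
  connected_component [set: X] x = connected_component [set: X] y.
Proof.
move=> xyK; apply: (@homotopic_component R X _ (fun=> x) (fun=> y) x).
by apply: contiguous_homotopic => // z; exact: cst_continuous.
Qed.

End Realization.

Local Close Scope classical_set_scope.

(** * Order complexes *)

Section OrderComplex.
Context {d : Order.disp_t} {P : finPOrderType d}.

Lemma order_complexP (s : {set P}) :
  reflect (s != finset.set0 /\ {in s &, forall u v, (u >=< v)%O})
    (s \in order_complex P).
Proof.
rewrite inE; apply: (iffP andP) => -[s0 cs]; split=> //.
  by move=> u v us vs; exact: (forall_inP (forall_inP cs u us)).
by apply/forall_inP => u us; apply/forall_inP => v; apply: cs.
Qed.

Lemma vertex_chain (v : P) : [set v] \in order_complex P.
Proof.
apply/order_complexP; split; first by apply/set0Pn; exists v; rewrite inE.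
by move=> u w /finset.set1P -> /finset.set1P ->; exact: comparablexx.
Qed.

Lemma euler_charE :
  euler_char P = \sum_(s in order_complex P) (-1) ^+ #|s|.-1.
Proof.
rewrite /euler_char.
transitivity (\sum_(i < #|P|) \sum_(s in order_complex P | #|s| == i.+1)
   (-1) ^+ #|s|.-1 : int).
  apply: eq_bigr => i _.
  rewrite (eq_bigr (fun=> (-1) ^+ i)) => [|s /andP[_ /eqP ->] //].
  by rewrite sumr_const -natz mulr_natr cardsE.
rewrite (exchange_big_dep (mem (order_complex P))) /=; last first.
  by move=> ? ? _ /andP[].
apply: eq_bigr => s sK.
have s_gt0 : (0 < #|s|)%N by rewrite card_gt0; case/order_complexP: sK.
have lts : (#|s|.-1 < #|P|)%N by rewrite prednK // max_card.
rewrite (big_pred1 (Ordinal lts)) // => i.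
by rewrite /= sK -val_eqE /= -[RHS]eqSS prednK // eq_sym.
Qed.

End OrderComplex.

(** * Posets partitioned into cones *)

(** A disjoint union of cones indexed by I, given by maps rather than by a
    partition because these maps also induce the two halves of the homotopy
    equivalence with I. *)
Definition cone_partition {d : Order.disp_t} (P : finPOrderType d)
    (I : finType) (piece : P -> I) (apex : I -> P) : Prop :=
  [/\ forall u v, (u <= v)%O -> piece u = piece v,
      cancel apex piece
    & forall v, (v <= apex (piece v))%O].

Section ConePartition.
Context {d : Order.disp_t} {P : finPOrderType d} {I : finType}.
Context (piece : P -> I) (apex : I -> P) (cones : cone_partition piece apex).

Lemma chain_fibre (s : {set P}) : s \in order_complex P ->
  {in s &, forall u v, piece u = piece v}.
Proof.
have [piece_mono _ _] := cones; case/order_complexP => _ cs u v us vs.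
by case/orP: (cs u v us vs) => /piece_mono.
Qed.

Lemma cone_chain (s : {set P}) (i : I) : {in s &, forall u v, (u >=< v)%O} ->
  {in s, forall v, piece v = i} -> apex i |: s \in order_complex P.
Proof.
have [_ _ le_apex] := cones; move=> cs si; apply/order_complexP; split.
  by apply/set0Pn; exists (apex i); exact: finset.setU11.
have le v : v \in apex i |: s -> (v <= apex i)%O.
  by case/finset.setU1P => [->//|/si <-].
move=> u v /[dup] /le ui /finset.setU1P[->|us] /[dup] /le vi.
all: case/finset.setU1P => [->|vs].
- exact: comparablexx.
- exact: ge_comparable.
- exact: le_comparable.
- exact: cs.
Qed.

(** Inserting the apex is a bijection from the nonempty chains of the fibre
    avoiding it to those containing it, except for the singleton of the apex,
    which would come from the empty chain; it changes the sign, and the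
    singleton contributes the 1. *)
Lemma cone_euler_char (i : I) :
  \sum_(s in order_complex P | [forall v in s, piece v == i]) (-1) ^+ #|s|.-1
    = 1 :> int.
Proof.
have [_ apexK _] := cones; set t := apex i.
rewrite (bigID (fun s : {set P} => t \in s)) /=.
rewrite (bigD1 [set t]) /=; last first.
  rewrite vertex_chain finset.set11 andbT; apply/forall_inP.
  by move=> v /finset.set1P ->; rewrite apexK.
rewrite cards1 expr0 -addrA -[RHS]addr0; congr (_ + _).
rewrite (reindex_onto (fun s => t |: s) (fun s => s :\ t)) /=; last first.
  by move=> s /andP[/andP[_ ts] _]; exact: finset.setD1K.
rewrite (eq_bigl (fun s => (s \in order_complex P) &&
    [forall v in s, piece v == i] && (t \notin s))); last first.
  move=> s; rewrite finset.setU11 andbT.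
  have [ts|ts] := boolP (t \in s).
    rewrite andbF; apply/negbTE/negP => /andP[_ /eqP E].
    by move: ts; rewrite -E finset.setD11.
  rewrite finset.setU1K // eqxx !andbT.
  apply/andP/andP => [[/andP[tsK si] st]|[sK si]].
    case/order_complexP: (tsK) => _ cs; split; last first.
      by apply/forall_inP => v vs; apply: (forall_inP si); exact: finset.setU1r.
    apply/order_complexP; split.
      by apply: contraNneq st => ->; rewrite finset.setU0.
    by move=> u v us vs; apply: cs; exact: finset.setU1r.
  case/order_complexP: sK => /set0Pn[v vs] cs; split.
    rewrite cone_chain // => [|u us]; last exact/eqP/(forall_inP si).
    apply/forall_inP => u /finset.setU1P[->|]; last exact: (forall_inP si).
    by rewrite apexK.
  apply: contraNneq ts => E.
  by have := finset.setU1r t vs; rewrite E => /finset.set1P <-.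
rewrite -big_split big1 //= => s /andP[/andP[/order_complexP[s0 _] _] ts].
have s_gt0 : (0 < #|s|)%N by rewrite card_gt0.
rewrite cardsU1 ts add1n -[X in (-1) ^+ X](prednK s_gt0).
by rewrite exprS mulN1r addNr.
Qed.

Lemma cone_partition_euler_char : euler_char P = #|I|.
Proof.
rewrite euler_charE.
transitivity (\sum_(i : I) \sum_(s in order_complex P |
    [forall v in s, piece v == i]) (-1) ^+ #|s|.-1 : int).
  rewrite (exchange_big_dep (mem (order_complex P))) /=; last first.
    by move=> ? ? _ /andP[].
  apply: eq_bigr => s sK.
  have /set0Pn[v vs] : s != finset.set0 by case/order_complexP: sK.
  rewrite (big_pred1 (piece v)) // => i; rewrite sK /=.
  apply/forall_inP/eqP => [/(_ v vs)/eqP //|-> u us].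
  by apply/eqP; exact: (chain_fibre sK).
rewrite (eq_bigr (fun=> 1)); last by move=> i _; exact: cone_euler_char.
by rewrite sumr_const natz.
Qed.

(** The value of piece on the vertices of a simplex is a locally constant map to
    I, a vertex v of the simplex of x being one also for all points near x.
    Its section through the apexes is contiguous to the identity. *)
Lemma cone_partition_homotopy_equivalent (R : realType) :
  homotopy_equivalent R (realization R (order_complex P)) (discrete_topology I).
Proof.
have [_ apexK _] := cones; pose X := realization R (order_complex P).
have nonempty (x : X) : exists v, v \in carrier x.
  by apply/set0Pn; case/order_complexP: (carrier_simplex x).
have /choice[f fE] : forall x : X,
    exists i, {in carrier x, forall v, piece v = i}.
  move=> x; have [v vx] := nonempty x.
  by exists (piece v) => u ux; exact: (chain_fibre (carrier_simplex x)).
have fv (x : X) v : v \in carrier x -> f x = piece v by move/(fE x).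
pose g (i : discrete_topology I) : X := vertex R (vertex_chain (apex i)).
have cf : continuous (f : X -> discrete_topology I).
  move=> x A /nbhs_singleton Ax; have [v vx] := nonempty x.
  apply: (@filterS _ _ _ [set y : X | v \in carrier y]%classic).
    by move=> y /= vy; rewrite /= (fv _ _ vy) -(fv _ _ vx).
  by apply: open_nbhs_nbhs; split=> //; exact: open_star.
have cg : continuous g by apply/continuousP => A _; exact: discrete_open.
have fgE : f \o g = id.
  apply/funext => i /=; rewrite (fv _ (apex i)) ?apexK //.
  by rewrite carrier_vertex finset.set11.
exists f, g; split=> //.
- apply: contiguous_homotopic.
  + by move=> x; apply: continuous_comp; [exact: cf|exact: cg].
  + by move=> x; exact: cvg_id.
  + move=> x /=; rewrite carrier_vertex; apply: cone_chain; last exact: fE.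
    by case/order_complexP: (carrier_simplex x).
- rewrite fgE; exists snd; split=> //.
  by apply: continuous_subspaceT => x; exact: cvg_snd.
Qed.

End ConePartition.

(** * Cosets of p-subgroups *)

Section Cosets.
Local Open Scope group_scope.
Context {gT : finGroupType} {p : nat} {G : {group gT}}.
Local Notation C := (coset_poset p G).

Lemma pcosetsP (A : {set gT}) :
  reflect (exists (H : {group gT}) (x : gT),
             [/\ H \subset G, p.-group H, x \in G & A = H :* x])
          (A \in pcosets p G).
Proof.
rewrite inE; apply: (iffP existsP).
  by case=> H /exists_inP[x xG /and3P[HG pH /eqP AE]]; exists H, x.
case=> H [x [HG pH xG AE]]; exists H; apply/exists_inP; exists x => //.
by apply/and3P; split=> //; apply/eqP.
Qed.

Lemma pcoset_mem (A : C) : exists2 x, x \in G & x \in coset_val A.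
Proof.
case: A => A /= /pcosetsP[H [x [_ _ xG ->]]].
by exists x => //; exact: rcoset_refl.
Qed.

Lemma singleton_pcoset (x : gT) : x \in G -> [set x] \in pcosets p G.
Proof.
move=> xG; apply/pcosetsP; exists 1%G, x; split=> //; first exact: sub1G.
  exact: pgroup1.
by rewrite mul1g.
Qed.

Lemma index_Sylow (P : {group gT}) :
  p.-Sylow(G) P -> (#|G : P| = (#|G| `_ p^')%N).
Proof.
move=> sylP; apply/eqP; rewrite -(eqn_pmul2l (cardG_gt0 P)).
by rewrite Lagrange ?(pHall_sub sylP) // (card_Hall sylP) partnC.
Qed.

Section NormalSylow.
Context (P : {group gT}) (sylP : p.-Sylow(G) P) (nPG : P <| G).

Lemma mul_pcoset (A : C) x : x \in coset_val A -> P * A = P :* x.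
Proof.
case: A => A /= /pcosetsP[H [y [HG pH _ ->]]] /rcoset_eqP <-.
by rewrite mulgA mulGSid // (sub_normal_Hall sylP).
Qed.

(** The apexes are the cosets of P.  Comparable cosets of p-subgroups share an
    element x and so lie in the same P x, because the normal subgroup P contains
    every p-subgroup. *)
Lemma normal_Sylow_cones n : n = #|G : P| ->
  exists (piece : C -> 'I_n) (apex : 'I_n -> C), cone_partition piece apex.
Proof.
move=> ->; have PP : P :* 1 \in rcosets P G by apply/rcosetsP; exists 1.
pose piece (A : C) := enum_rank_in PP (P * A).
have apexP (i : 'I_#|rcosets P G|) : enum_val i \in pcosets p G.
  have /rcosetsP[x xG ->] := enum_valP i; apply/pcosetsP; exists P, x.
  by split=> //; [exact: pHall_sub sylP|exact: pHall_pgroup sylP].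
pose apex i : C := CosetPoset (apexP i).
have mulP (A : C) : P * A \in rcosets P G.
  have [x xG xA] := pcoset_mem A.
  by rewrite (mul_pcoset xA); apply/rcosetsP; exists x.
exists piece, apex; split.
- move=> u v; have [x xG xu] := pcoset_mem u => uv.
  have /fintype.subsetP/(_ x xu) xv : coset_val u \subset coset_val v by [].
  by rewrite /piece (mul_pcoset xu) (mul_pcoset xv).
- move=> i; rewrite /piece /=.
  suff -> : P * enum_val i = enum_val i by exact: enum_valK_in.
  have /rcosetsP[x xG ->] := enum_valP i.
  by rewrite mulgA mulGid.
- move=> A; suff: coset_val A \subset enum_val (piece A) by [].
  by rewrite /piece enum_rankK_in ?mulP // mulG_subr.
Qed.

End NormalSylow.

Section Components.
Context (R : realType).
Local Notation X := (realization R (order_complex C)).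

(** Taking any subset of the group, with a dummy value outside the poset,
    avoids carrying membership proofs around. *)
Definition coset_component (A : {set gT}) : set X :=
  if (insub A : option C) is Some u then
    connected_component [set: X]%classic (vertex R (vertex_chain u))
  else set0.

Lemma coset_component_sub (A B : {set gT}) :
  A \in pcosets p G -> B \in pcosets p G -> A \subset B ->
  coset_component A = coset_component B.
Proof.
move=> AC BC AB; rewrite /coset_component !insubT.
apply: same_simplex_component; rewrite !carrier_vertex.
have le_AB : (Sub A AC <= Sub B BC :> C)%O by [].
apply/order_complexP; split.
  by apply/set0Pn; exists (Sub A AC); rewrite !inE eqxx.
move=> u v /finset.set2P[]-> /finset.set2P[]->; rewrite ?comparablexx //.
  exact: le_comparable.
exact: ge_comparable.
Qed.

Lemma component_singleton (w : X) : exists2 x, x \in G &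
  connected_component [set: X]%classic w = coset_component [set x].
Proof.
have wK := carrier_simplex w.
have /set0Pn[A Aw] : carrier w != finset.set0 by case/order_complexP: wK.
have [x xG xA] := pcoset_mem A; exists x => //.
have -> : coset_component [set x] = coset_component (coset_val A).
  apply: coset_component_sub; [exact: singleton_pcoset|exact: valP|].
  by rewrite finset.sub1set.
rewrite /coset_component (valK A).
apply: same_simplex_component; rewrite carrier_vertex finset.setUC.
by rewrite (finset.setUidPr _) // finset.sub1set.
Qed.

Lemma component_pcoset (H : {group gT}) x h : H \subset G -> p.-group H ->
  x \in G -> h \in H ->
  coset_component [set (h * x)%g] = coset_component (H :* x).
Proof.
move=> HG pH xG hH; apply: coset_component_sub.
- by apply: singleton_pcoset; rewrite groupM // (fintype.subsetP HG).
- by apply/pcosetsP; exists H, x.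
- by rewrite finset.sub1set mem_rcoset mulgK.
Qed.

(** The subgroup generated by the p-subgroups of G would serve as well, being
    in fact the same; with this description, that the component of {x} depends
    only on the coset of x is immediate. *)
Definition same_component_set : {set gT} :=
  [set g in G | [forall x in G,
     `[< coset_component [set (g * x)%g] = coset_component [set x] >]]].

Lemma same_component_setP g :
  reflect (g \in G /\ {in G, forall x,
             coset_component [set (g * x)%g] = coset_component [set x]})
          (g \in same_component_set).
Proof.
rewrite inE; apply: (iffP andP) => -[gG gx]; split=> //.
  by move=> x xG; apply/asboolP; exact: (forall_inP gx).
by apply/forall_inP => x xG; apply/asboolP; exact: gx.
Qed.

Lemma same_component_group_set : group_set same_component_set.
Proof.
apply/group_setP; split.
  by apply/same_component_setP; split=> // x xG; rewrite mul1g.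
move=> g h /same_component_setP[gG gx] /same_component_setP[hG hx].
apply/same_component_setP; split; first exact: groupM.
by move=> x xG; rewrite -mulgA gx ?groupM // hx.
Qed.

Definition same_component_group : {group gT} := group same_component_group_set.
Local Notation S := same_component_group.

Lemma pgroup_sub_same_component (H : {group gT}) :
  H \subset G -> p.-group H -> H \subset S.
Proof.
move=> HG pH; apply/fintype.subsetP => h hH; apply/same_component_setP.
split=> [|x xG]; first exact: (fintype.subsetP HG).
rewrite (component_pcoset HG) //.
by rewrite -(component_pcoset HG pH xG (group1 H)) mul1g.
Qed.

Lemma components_le_index : (components X #<= `I_#|G : S|)%card.
Proof.
have := @card_II #|rcosets S G|; case/card_eqPle => _.
apply: card_le_trans.
apply: card_le_trans
  (card_image_le (fun i => coset_component [set repr (enum_val i)]) _).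
apply: subset_card_le => _ [w _ <-].
have [x xG ->] := component_singleton w.
have Sx : S :* x \in rcosets S G by apply/rcosetsP; exists x.
exists (enum_rank_in Sx (S :* x)) => //.
rewrite enum_rankK_in //; have /rcosetP[g gS ->] := mem_repr_rcoset S x.
by have /same_component_setP[_ ->] := gS.
Qed.

Lemma p_closed_of_components :
  (components X #= `I_(#|G| `_ p^')%N)%card -> p_closed p G.
Proof.
move=> cX; have [P sylP] := Sylow_exists p G; exists P => //.
have PG := pHall_sub sylP; have pP := pHall_pgroup sylP.
have SG : S \subset G by apply/fintype.subsetP => g /same_component_setP[].
have le_index : (#|G : P| <= #|G : S|)%N.
  rewrite (index_Sylow sylP) -card_le_II -(card_le_eql cX).
  exact: components_le_index.
have SP : S :=: P.
  apply/esym/eqP; rewrite eqEcard pgroup_sub_same_component //=.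
  rewrite -(leq_pmul2r (indexg_gt0 G P)) (Lagrange PG) -(Lagrange SG).
  by rewrite leq_mul2l le_index orbT.
apply/normalP; split=> // x xG.
apply/eqP; rewrite eqEcard cardJg leqnn andbT.
suff: P :^ x \subset S by rewrite SP.
apply: (@pgroup_sub_same_component (P :^ x)%G); first exact: conj_subG.
by rewrite /= pgroupJ.
Qed.

End Components.
End Cosets.

Theorem theorem2 (R : realType) (gT : finGroupType) (G : {group gT}) (p : nat)
    (p_pr : prime p) :
  let n := (#|G| `_ p^')%N in
  let C := coset_poset p G in
  let X := realization R (order_complex C) in
  [/\ p_closed p G <-> homotopy_equivalent R X (discrete_topology 'I_n),
      homotopy_equivalent R X (discrete_topology 'I_n) <->
        (components X #= `I_n)%card
    & p_closed p G -> euler_char C = Posz n].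
Proof.
move=> n C X.
have cones : p_closed p G ->
    exists (piece : C -> 'I_n) (apex : 'I_n -> C), cone_partition piece apex.
  case=> P sylP nPG; apply: (normal_Sylow_cones sylP nPG).
  by rewrite (index_Sylow sylP).
have he_of_closed :
    p_closed p G -> homotopy_equivalent R X (discrete_topology 'I_n).
  case/cones => piece [apex ct].
  exact: (cone_partition_homotopy_equivalent ct).
have comp_of_he : homotopy_equivalent R X (discrete_topology 'I_n) ->
    (components X #= `I_n)%card.
  move=> /homotopy_equivalent_discrete_components cX.
  by apply: card_eq_trans cX _; rewrite card_eq_sym; exact: card_II.
have closed_of_comp := @p_closed_of_components gT p G R.
split.
- by split=> // /comp_of_he.
- by split=> // /closed_of_comp.
- case/cones => piece [apex ct].
  by rewrite (cone_partition_euler_char ct) card_ord.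
Qed.
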